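(* In a tangent category with negatives, let $K:T^2(M)\to T(M)$ be an affine vertical connection on $M$ with torsion $V_K:=c_MK-K:T^2(M)\to T(M)$, and for vector fields $w_1,w_2:M\to T(M)$ let $T_K(w_1,w_2):=w_2T(w_1)V_K$ be the torsion tensor. Then $$T_K(w_1,w_2)=\nabla_K(w_1,w_2)-\nabla_K(w_2,w_1)-[w_1,w_2],$$ where $\nabla_K(w,s):=wT(s)K$.
   Context: Conventions: composites are written in diagrammatic order ($fg$ means first $f$, then $g$). $\langle f,g\rangle$ is the induced map into a pullback, $\pi_0,\pi_1$ are projections. Component subscripts of natural transformations are often omitted. An additive bundle over $M$ is a map $q:E\to M$ whose finite wide pullbacks $E_n$ along itself exist, with maps $+_q:E_2\to E$, $0_q:M\to E$ making $q$ a commutative monoid in the slice over $M$. An additive bundle morphism $(f_1,f_0)$ from $q:E\to M$ to $q':E'\to M'$ is a pair $f_1:E\to E'$, $f_0:M\to M'$ with $f_1q'=qf_0$ preserving addition and zero. A tangent category is a category with a functor $T$ and natural transformations $p:T\to 1$, $0:1\to T$, $+:T_2\to T$, $\ell:T\to T^2$, $c:T^2\to T^2$ such that: each $(p_M,+_M,0_M)$ is an additive bundle, the wide pullbacks $T_nM$ of $p_M$ exist and are preserved by each $T^k$; $(\ell_M,0_M)$ is an additive bundle morphism from $(p_M,+_M,0_M)$ to $(T(p_M),T(+_M),T(0_M))$; $(c_M,1)$ is an additive bundle morphism from $(T(p_M),T(+_M),T(0_M))$ to $(p_{TM},+_{TM},0_{TM})$; $c^2=1$, $\ell c=\ell$,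 $\ell_M\ell_{TM}=\ell_MT(\ell_M)$, $T(c)cT(c)=cT(c)c$, $\ell_{TM}T(c_M)c_{TM}=c_MT(\ell_M)$; and the square with top $\mu:=\langle\pi_0\ell,\pi_10\rangle T(+):T_2M\to T^2M$, left $\pi_0p=\pi_1p$, right $T(p)$, bottom $0_M$ is a pullback preserved by each $T^k$. It has negatives if there is a natural transformation $n:T\to T$ making each $p_M$ a fibrewise abelian group; $f-g:=\langle f,gn\rangle+$. Differences of maps into $T(M)$ are taken in $p_M$. For $f:X\to T^2(M)$ with $fT(p)=fpp0$, $\{f\}:X\to T(M)$ denotes $f_{|\mu}\pi_0$ where $f_{|\mu}:X\to T_2(M)$ is the unique map with $f_{|\mu}\mu=f$. A vector field on $M$ is a section $w:M\to T(M)$ of $p_M$. The Lie bracket is $[w_1,w_2]:=\{w_1T(w_2)-w_2T(w_1)c\}$, the difference being taken in $p_{T(M)}:T^2(M)\to T(M)$. An affine vertical connection on $M$ is a map $K:T^2(M)\to T(M)$ with $\ell_MK=1$, $Kp=pp$, $K\ell_M=\ell_{TM}T(K)$ and $K\ell_M=T(\ell_M)c_{TM}T(K)$. *)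

(* Defs.v *)
From mathcomp Require Import ssreflect ssrfun ssrbool eqtype ssrnat fintype.

Set Implicit Arguments.
Unset Strict Implicit.
Unset Printing Implicit Defensive.

(* Categories. Composition is in diagrammatic order: [f ;; g] is first [f],
   then [g].  Morphisms are compared with Leibniz equality. *)

Record Category : Type := {
  Ob :> Type;
  Hom : Ob -> Ob -> Type;
  idm : forall X, Hom X X;
  comp : forall X Y Z, Hom X Y -> Hom Y Z -> Hom X Z;
  comp_idl : forall X Y (f : Hom X Y), comp (idm X) f = f;
  comp_idr : forall X Y (f : Hom X Y), comp f (idm Y) = f;
  comp_assoc : forall W X Y Z (f : Hom W X) (g : Hom X Y) (h : Hom Y Z),
    comp (comp f g) h = comp f (comp g h)
}.

Arguments idm {c} X.

Declare Scope cat_scope.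
Delimit Scope cat_scope with cat.
Local Open Scope cat_scope.

Notation "X ~> Y" := (Hom X Y) (at level 70, no associativity) : cat_scope.
Notation "f ;; g" := (comp f g) (at level 45, left associativity) : cat_scope.

Record Functor (C D : Category) : Type := {
  fobj :> C -> D;
  fmap : forall X Y : C, X ~> Y -> fobj X ~> fobj Y;
  fmap_id : forall X : C, fmap (idm X) = idm (fobj X);
  fmap_comp : forall (X Y Z : C) (f : X ~> Y) (g : Y ~> Z),
    fmap (f ;; g) = fmap f ;; fmap g
}.

Definition id_functor (C : Category) : Functor C C :=
  {| fobj := fun X : C => X;
     fmap := fun _ _ f => f;
     fmap_id := fun _ => erefl;
     fmap_comp := fun _ _ _ _ _ => erefl |}.

Section CompFunctor.

Variables (C D E : Category) (F : Functor C D) (G : Functor D E).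

Lemma comp_functor_id (X : C) : fmap G (fmap F (idm X)) = idm (G (F X)).
Proof. by rewrite !fmap_id. Qed.

Lemma comp_functor_comp (X Y Z : C) (f : X ~> Y) (g : Y ~> Z) :
  fmap G (fmap F (f ;; g)) = fmap G (fmap F f) ;; fmap G (fmap F g).
Proof. by rewrite !fmap_comp. Qed.

Definition comp_functor : Functor C E :=
  {| fobj := fun X => G (F X);
     fmap := fun _ _ f => fmap G (fmap F f);
     fmap_id := comp_functor_id;
     fmap_comp := comp_functor_comp |}.

End CompFunctor.

Fixpoint iter_functor (C : Category) (F : Functor C C) (k : nat) :
    Functor C C :=
  if k is j.+1 then comp_functor (iter_functor F j) F else id_functor C.

(* Being a limit is structure here: the (unique) mediating maps are given by a
   function, so that pairings can be written as terms. *)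

Section Limits.

Variable C : Category.

Record IsPullback (P A B D : C) (top : P ~> A) (left : P ~> B)
    (right : A ~> D) (bottom : B ~> D) : Type := {
  pb_comm : top ;; right = left ;; bottom;
  pb_lift : forall (X : C) (f : X ~> A) (g : X ~> B),
    f ;; right = g ;; bottom -> X ~> P;
  pb_lift_top : forall (X : C) (f : X ~> A) (g : X ~> B)
    (H : f ;; right = g ;; bottom), pb_lift H ;; top = f;
  pb_lift_left : forall (X : C) (f : X ~> A) (g : X ~> B)
    (H : f ;; right = g ;; bottom), pb_lift H ;; left = g;
  pb_unique : forall (X : C) (u v : X ~> P),
    u ;; top = v ;; top -> u ;; left = v ;; left -> u = v
}.

(* The wide pullback of [n] copies of [q]; the map [base] to [M] makes the
   notion correct for [n = 0], where the wide pullback is [M] itself. *)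
Record IsWidePullback (n : nat) (E M : C) (q : E ~> M) (P : C)
    (pr : 'I_n -> P ~> E) (base : P ~> M) : Type := {
  wp_comm : forall i, pr i ;; q = base;
  wp_lift : forall (X : C) (f : 'I_n -> X ~> E) (g : X ~> M),
    (forall i, f i ;; q = g) -> X ~> P;
  wp_lift_pr : forall (X : C) (f : 'I_n -> X ~> E) (g : X ~> M)
    (H : forall i, f i ;; q = g) i, wp_lift H ;; pr i = f i;
  wp_lift_base : forall (X : C) (f : 'I_n -> X ~> E) (g : X ~> M)
    (H : forall i, f i ;; q = g), wp_lift H ;; base = g;
  wp_unique : forall (X : C) (u v : X ~> P),
    (forall i, u ;; pr i = v ;; pr i) -> u ;; base = v ;; base -> u = v
}.

End Limits.

Section AdditiveBundles.

Variable C : Category.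

(* The data underlying an additive bundle [q : E -> M]. *)
Record BundleData (E M : C) (q : E ~> M) : Type := {
  bn : nat -> C;
  bn_pr : forall n, 'I_n -> bn n ~> E;
  bn_base : forall n, bn n ~> M;
  bn_wp : forall n, IsWidePullback q (@bn_pr n) (bn_base n);
  badd : bn 2 ~> E;
  bzero : M ~> E
}.

Section Pairing.

Variables (E M : C) (q : E ~> M) (B : BundleData q).

Definition pr0 : bn B 2 ~> E := bn_pr B (@Ordinal 2 0 isT).
Definition pr1 : bn B 2 ~> E := bn_pr B (@Ordinal 2 1 isT).

Definition pr0_3 : bn B 3 ~> E := bn_pr B (@Ordinal 3 0 isT).
Definition pr1_3 : bn B 3 ~> E := bn_pr B (@Ordinal 3 1 isT).
Definition pr2_3 : bn B 3 ~> E := bn_pr B (@Ordinal 3 2 isT).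

Lemma bn_pr_eq n (i j : 'I_n) : bn_pr B i ;; q = bn_pr B j ;; q.
Proof. by rewrite !(wp_comm (bn_wp B n)). Qed.

Definition pair_fam (X : C) (f g : X ~> E) (i : 'I_2) : X ~> E :=
  if nat_of_ord i is 0 then f else g.

Lemma pair_fam_over (X : C) (f g : X ~> E) (H : f ;; q = g ;; q) i :
  pair_fam f g i ;; q = f ;; q.
Proof. by rewrite /pair_fam; case: (nat_of_ord i). Qed.

Definition bpair (X : C) (f g : X ~> E) (H : f ;; q = g ;; q) : X ~> bn B 2 :=
  wp_lift (bn_wp B 2) (pair_fam_over H).

Lemma bpair0 (X : C) (f g : X ~> E) (H : f ;; q = g ;; q) :
  bpair H ;; pr0 = f.
Proof. exact: wp_lift_pr. Qed.

Lemma bpair1 (X : C) (f g : X ~> E) (H : f ;; q = g ;; q) :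
  bpair H ;; pr1 = g.
Proof. exact: wp_lift_pr. Qed.

Definition bsum (X : C) (f g : X ~> E) (H : f ;; q = g ;; q) : X ~> E :=
  bpair H ;; badd B.

Section Laws.

Hypothesis add_over : badd B ;; q = pr0 ;; q.

Lemma bsum_over (X : C) (f g : X ~> E) (H : f ;; q = g ;; q) :
  bsum H ;; q = f ;; q.
Proof. by rewrite /bsum comp_assoc add_over -comp_assoc bpair0. Qed.

Lemma bassoc_overl : bsum (bn_pr_eq _ _ : pr0_3 ;; q = pr1_3 ;; q) ;; q
                     = pr2_3 ;; q.
Proof. by rewrite bsum_over; exact: bn_pr_eq. Qed.

Lemma bassoc_overr : pr0_3 ;; q =
  bsum (bn_pr_eq _ _ : pr1_3 ;; q = pr2_3 ;; q) ;; q.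
Proof. by rewrite bsum_over; exact: bn_pr_eq. Qed.

Hypothesis zero_over : bzero B ;; q = idm M.

Lemma bzero_overl : (q ;; bzero B) ;; q = idm E ;; q.
Proof. by rewrite comp_assoc zero_over comp_idr comp_idl. Qed.

Lemma bzero_overr : idm E ;; q = (q ;; bzero B) ;; q.
Proof. by rewrite bzero_overl. Qed.

End Laws.

(* [(+, 0)] is a commutative monoid structure on [q] in the slice over [M]. *)
Record IsAdditiveBundle : Prop := {
  ab_add_over : badd B ;; q = pr0 ;; q;
  ab_zero_over : bzero B ;; q = idm M;
  ab_assoc : bsum (bassoc_overl ab_add_over) = bsum (bassoc_overr ab_add_over);
  ab_comm : bsum (bn_pr_eq _ _ : pr1 ;; q = pr0 ;; q) = badd B;
  ab_unitl : bsum (bzero_overl ab_zero_over) = idm E;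
  ab_unitr : bsum (bzero_overr ab_zero_over) = idm E
}.

End Pairing.

Lemma bmor_over (E M E' M' : C) (q : E ~> M) (q' : E' ~> M')
    (B : BundleData q) (f1 : E ~> E') (f0 : M ~> M') :
  f1 ;; q' = q ;; f0 -> (pr0 B ;; f1) ;; q' = (pr1 B ;; f1) ;; q'.
Proof.
move=> H; rewrite !comp_assoc H -!comp_assoc.
by congr (_ ;; _); exact: bn_pr_eq.
Qed.

Record IsAdditiveMorphism (E M E' M' : C) (q : E ~> M) (q' : E' ~> M')
    (B : BundleData q) (B' : BundleData q')
    (f1 : E ~> E') (f0 : M ~> M') : Prop := {
  am_comm : f1 ;; q' = q ;; f0;
  am_add : badd B ;; f1 = bsum B' (bmor_over B am_comm);
  am_zero : bzero B ;; f1 = f0 ;; bzero B'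
}.

End AdditiveBundles.

(* The bundle [(F q, F +, F 0)], for [F] preserving the wide pullbacks of [q]. *)
Definition image_bundle (C D : Category) (F : Functor C D) (E M : C)
    (q : E ~> M) (B : BundleData q)
    (pres : forall n, IsWidePullback (fmap F q)
              (fun i => fmap F (@bn_pr _ _ _ _ B n i))
              (fmap F (bn_base B n))) : BundleData (fmap F q) :=
  {| bn := fun n => F (bn B n);
     bn_pr := fun n i => fmap F (bn_pr B i);
     bn_base := fun n => fmap F (bn_base B n);
     bn_wp := pres;
     badd := fmap F (badd B);
     bzero := fmap F (bzero B) |}.

(* All the structure and axioms of a tangent category except the universality
   of the vertical lift. *)
Record PreTangent (C : Category) : Type := {
  tT : Functor C C;
  tp : forall M : C, tT M ~> M;
  tp_nat : forall (M N : C) (f : M ~> N), fmap tT f ;; tp N = tp M ;; f;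

  tB : forall M : C, BundleData (tp M);
  tB_additive : forall M : C, IsAdditiveBundle (tB M);
  tB_pres : forall (k n : nat) (M : C),
    IsWidePullback (fmap (iter_functor tT k) (tp M))
      (fun i => fmap (iter_functor tT k) (@bn_pr _ _ _ _ (tB M) n i))
      (fmap (iter_functor tT k) (bn_base (tB M) n));
  tTB := fun M : C => image_bundle (F := tT) (B := tB M)
           (fun n => tB_pres 1 n M) : BundleData (fmap tT (tp M));

  tzero_nat : forall (M N : C) (f : M ~> N),
    f ;; bzero (tB N) = bzero (tB M) ;; fmap tT f;
  (* [T_2 f] is [<pr0 ;; T f, pr1 ;; T f>]. *)
  tadd_nat : forall (M N : C) (f : M ~> N),
    bsum (tB N) (bmor_over (tB M) (tp_nat f)) = badd (tB M) ;; fmap tT f;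

  tl : forall M : C, tT M ~> tT (tT M);
  tl_nat : forall (M N : C) (f : M ~> N),
    fmap tT f ;; tl N = tl M ;; fmap tT (fmap tT f);
  tc : forall M : C, tT (tT M) ~> tT (tT M);
  tc_nat : forall (M N : C) (f : M ~> N),
    fmap tT (fmap tT f) ;; tc N = tc M ;; fmap tT (fmap tT f);

  tl_additive : forall M : C,
    IsAdditiveMorphism (tB M) (tTB M) (tl M) (bzero (tB M));
  tc_additive : forall M : C,
    IsAdditiveMorphism (tTB M) (tB (tT M)) (tc M) (idm (tT M));

  tc_invol : forall M : C, tc M ;; tc M = idm _;
  tl_c : forall M : C, tl M ;; tc M = tl M;
  tl_l : forall M : C, tl M ;; tl (tT M) = tl M ;; fmap tT (tl M);
  tc_braid : forall M : C,
    fmap tT (tc M) ;; tc (tT M) ;; fmap tT (tc M)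
    = tc (tT M) ;; fmap tT (tc M) ;; tc (tT M);
  tl_tc : forall M : C,
    tl (tT M) ;; fmap tT (tc M) ;; tc (tT M) = tc M ;; fmap tT (tl M)
}.

Section VerticalLift.

Variables (C : Category) (X : PreTangent C) (M : C).

Notation T := (tT X).

Definition tzero (N : C) : N ~> T N := bzero (tB X N).
Definition tpr0 : bn (tB X M) 2 ~> T M := pr0 (tB X M).
Definition tpr1 : bn (tB X M) 2 ~> T M := pr1 (tB X M).

Lemma mu_over : (tpr0 ;; tl X M) ;; fmap T (tp X M)
              = (tpr1 ;; tzero (T M)) ;; fmap T (tp X M).
Proof.
rewrite !comp_assoc (am_comm (tl_additive X M)) -(tzero_nat X).
by rewrite -!comp_assoc; congr (_ ;; _); exact: bn_pr_eq.
Qed.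

(* [<pr0 l, pr1 0> T(+)], the pairing being into [T (T_2 M)], i.e. the pullback
   of [T p] along itself. *)
Definition mu : bn (tB X M) 2 ~> T (T M) := bsum (tTB X M) mu_over.

End VerticalLift.

Record TangentStructure (C : Category) : Type := {
  tpre :> PreTangent C;
  tmu_pb : forall M : C,
    IsPullback (mu tpre M) (tpr0 tpre M ;; tp tpre M)
      (fmap (tT tpre) (tp tpre M)) (tzero tpre M);
  tmu_pb_pres : forall (k : nat) (M : C),
    let Tk := iter_functor (tT tpre) k in
    IsPullback (fmap Tk (mu tpre M)) (fmap Tk (tpr0 tpre M ;; tp tpre M))
      (fmap Tk (fmap (tT tpre) (tp tpre M))) (fmap Tk (tzero tpre M))
}.

Lemma tneg_inv_over (C : Category) (X : PreTangent C)
    (neg : forall M : C, tT X M ~> tT X M)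
    (over : forall M : C, neg M ;; tp X M = tp X M) (M : C) :
  idm (tT X M) ;; tp X M = neg M ;; tp X M.
Proof. by rewrite comp_idl over. Qed.

Record Negatives (C : Category) (X : PreTangent C) : Type := {
  tneg : forall M : C, tT X M ~> tT X M;
  tneg_nat : forall (M N : C) (f : M ~> N),
    fmap (tT X) f ;; tneg N = tneg M ;; fmap (tT X) f;
  tneg_over : forall M : C, tneg M ;; tp X M = tp X M;
  tneg_inv : forall M : C,
    bsum (tB X M) (tneg_inv_over tneg_over M) = tp X M ;; tzero X M
}.

Section TangentCategoryWithNegatives.

Variables (C : Category) (X : TangentStructure C) (N : Negatives X).

Notation T := (tT X).
Notation p := (tp X).
Notation "0_ M" := (tzero X M) (at level 8, M at level 2, format "0_ M").
Notation c := (tc X).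
Notation l := (tl X).

Lemma tsub_over (Y M : C) (f g : Y ~> T M) :
  f ;; p M = g ;; p M -> f ;; p M = (g ;; tneg N M) ;; p M.
Proof. by move=> H; rewrite comp_assoc tneg_over. Qed.

Definition tsub (Y M : C) (f g : Y ~> T M) (H : f ;; p M = g ;; p M) :
    Y ~> T M :=
  bsum (tB X M) (tsub_over H).

Arguments tsub {Y M} f g H.

Lemma tsub_p (Y M : C) (f g : Y ~> T M) (H : f ;; p M = g ;; p M) :
  tsub f g H ;; p M = f ;; p M.
Proof. exact: (bsum_over (ab_add_over (tB_additive X M))). Qed.

Lemma bpair_unique (Y M : C) (u v : Y ~> bn (tB X M) 2) :
  u ;; tpr0 X M = v ;; tpr0 X M -> u ;; tpr1 X M = v ;; tpr1 X M -> u = v.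
Proof.
move=> H0 H1; apply: (wp_unique (bn_wp (tB X M) 2)); last first.
  by rewrite -(wp_comm (bn_wp (tB X M) 2) (@Ordinal 2 0 isT)) -!comp_assoc;
     congr (_ ;; _).
by case=> -[|[|//]] Hi; rewrite (bool_irrelevance Hi isT).
Qed.

Lemma bsum_congr (Y M : C) (f g f' g' : Y ~> T M) (H : f ;; p M = g ;; p M)
    (H' : f' ;; p M = g' ;; p M) :
  f = f' -> g = g' -> bsum (tB X M) H = bsum (tB X M) H'.
Proof.
move=> ef eg; congr (_ ;; _).
by apply: bpair_unique; rewrite /tpr0 /tpr1 ?bpair0 ?bpair1.
Qed.

Lemma bsum_precomp (Z Y M : C) (h : Z ~> Y) (f g : Y ~> T M)
    (H : f ;; p M = g ;; p M) (H' : (h ;; f) ;; p M = (h ;; g) ;; p M) :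
  h ;; bsum (tB X M) H = bsum (tB X M) H'.
Proof.
rewrite /bsum -comp_assoc; congr (_ ;; _).
by apply: bpair_unique; rewrite /tpr0 /tpr1 comp_assoc ?bpair0 ?bpair1.
Qed.

Lemma tsub_self (Y M : C) (f g : Y ~> T M) (H : f ;; p M = g ;; p M) :
  f = g -> tsub f g H = f ;; p M ;; 0_ M.
Proof.
move=> e; have H1 : f ;; idm _ ;; p M = f ;; tneg N M ;; p M.
  by rewrite !comp_assoc tneg_over comp_idl.
rewrite comp_assoc -(tneg_inv N) (bsum_precomp _ H1).
by apply: bsum_congr; rewrite ?comp_idr // e.
Qed.

Lemma tsub_fmap (Y M M' : C) (h : M ~> M') (f g : Y ~> T M)
    (H : f ;; p M = g ;; p M)
    (H' : (f ;; fmap T h) ;; p M' = (g ;; fmap T h) ;; p M') :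
  tsub f g H ;; fmap T h = tsub (f ;; fmap T h) (g ;; fmap T h) H'.
Proof.
rewrite /tsub {1}/bsum comp_assoc -tadd_nat.
have H1 : (f ;; fmap T h) ;; p M' = (g ;; tneg N M ;; fmap T h) ;; p M'.
  rewrite !comp_assoc !tp_nat -(comp_assoc (tneg N M)) tneg_over.
  by rewrite -!comp_assoc H.
rewrite /bsum -comp_assoc; congr (_ ;; _).
apply: bpair_unique; rewrite /tpr0 /tpr1 comp_assoc ?bpair0 ?bpair1.
  by rewrite -comp_assoc bpair0.
by rewrite -comp_assoc bpair1 !comp_assoc tneg_nat.
Qed.

(* [{f}], for [f] with [f T(p) = f p p 0]. *)
Definition bracket (Y M : C) (f : Y ~> T (T M))
    (H : f ;; fmap T (p M) = f ;; p (T M) ;; p M ;; 0_ M) : Y ~> T M :=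
  pb_lift (tmu_pb X M) H ;; tpr0 X M.

Lemma bracket_p (Y M : C) (f : Y ~> T (T M))
    (H : f ;; fmap T (p M) = f ;; p (T M) ;; p M ;; 0_ M) :
  bracket H ;; p M = f ;; p (T M) ;; p M.
Proof. by rewrite /bracket comp_assoc pb_lift_left. Qed.

Record VectorField (M : C) : Type := {
  vf :> M ~> T M;
  vf_sec : vf ;; p M = idm M
}.

Section LieBracket.

Variables (M : C) (w1 w2 : VectorField M).

Lemma vf_fmap_p (w w' : VectorField M) : w ;; fmap T w' ;; p (T M) = w'.
Proof. by rewrite comp_assoc tp_nat -comp_assoc vf_sec comp_idl. Qed.

Lemma vf_fmap_Tp (w w' : VectorField M) :
  w ;; fmap T w' ;; fmap T (p M) = w.
Proof. by rewrite comp_assoc -fmap_comp vf_sec fmap_id comp_idr. Qed.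

Lemma tc_p (K : C) : c K ;; p (T K) = fmap T (p K).
Proof. by rewrite (am_comm (tc_additive X K)) comp_idr. Qed.

Lemma tc_Tp (K : C) : c K ;; fmap T (p K) = p (T K).
Proof. by rewrite -tc_p -comp_assoc tc_invol comp_idl. Qed.

Lemma lie_over :
  (w1 ;; fmap T w2) ;; p (T M) = (w2 ;; fmap T w1 ;; c M) ;; p (T M).
Proof. by rewrite vf_fmap_p comp_assoc tc_p vf_fmap_Tp. Qed.

Definition lie_diff : M ~> T (T M) :=
  tsub (w1 ;; fmap T w2) (w2 ;; fmap T w1 ;; c M) lie_over.

Lemma lie_vertical :
  lie_diff ;; fmap T (p M) = lie_diff ;; p (T M) ;; p M ;; 0_ M.
Proof.
rewrite /lie_diff tsub_p.
have e : w1 ;; fmap T w2 ;; fmap T (p M)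
       = w2 ;; fmap T w1 ;; c M ;; fmap T (p M).
  by rewrite vf_fmap_Tp [RHS]comp_assoc tc_Tp vf_fmap_p.
rewrite (@tsub_fmap _ _ _ _ _ _ _ (congr1 (fun h => h ;; p M) e)).
by rewrite tsub_self // vf_fmap_Tp vf_fmap_p !vf_sec.
Qed.

Definition lie : M ~> T M := bracket lie_vertical.

Lemma lie_p : lie ;; p M = idm M.
Proof. by rewrite /lie bracket_p /lie_diff tsub_p vf_fmap_p vf_sec. Qed.

End LieBracket.

Record AffineVerticalConnection (M : C) : Type := {
  avc :> T (T M) ~> T M;
  avc_l : l M ;; avc = idm (T M);
  avc_p : avc ;; p M = p (T M) ;; p M;
  avc_lin : avc ;; l M = l (T M) ;; fmap T avc;
  avc_linT : avc ;; l M = fmap T (l M) ;; c (T M) ;; fmap T avc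
}.

Section Connection.

Variables (M : C) (K : AffineVerticalConnection M).

Lemma torsion_over : (c M ;; K) ;; p M = K ;; p M.
Proof. by rewrite comp_assoc avc_p -comp_assoc tc_p tp_nat. Qed.

Definition torsion : T (T M) ~> T M := tsub (c M ;; K) K torsion_over.

Definition torsion_tensor (w1 w2 : VectorField M) : M ~> T M :=
  w2 ;; fmap T w1 ;; torsion.

Definition nabla (w s : VectorField M) : M ~> T M := w ;; fmap T s ;; K.

Lemma nabla_p (w s : VectorField M) : nabla w s ;; p M = idm M.
Proof. by rewrite /nabla comp_assoc avc_p -comp_assoc vf_fmap_p vf_sec. Qed.

Lemma nabla_over (w1 w2 : VectorField M) :
  nabla w1 w2 ;; p M = nabla w2 w1 ;; p M.
Proof. by rewrite !nabla_p. Qed.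

Lemma nabla_lie_over (w1 w2 : VectorField M) :
  tsub (nabla w1 w2) (nabla w2 w1) (nabla_over w1 w2) ;; p M = lie w1 w2 ;; p M.
Proof. by rewrite tsub_p nabla_p lie_p. Qed.

End Connection.

End TangentCategoryWithNegatives.

Arguments VectorField {C} X M.
Arguments AffineVerticalConnection {C} X M.
Arguments tsub {C X} N {Y M} f g H.

(* Main.v *)
From mathcomp Require Import ssreflect ssrfun ssrbool eqtype ssrnat fintype.
Require Import Defs.

Set Implicit Arguments.
Unset Strict Implicit.
Unset Printing Implicit Defensive.

(** Write [f = w1 T(w2)], [g = w2 T(w1) c] and [h = w2 T(w1)].  By definition
    the torsion tensor is [g K - h K] and the two covariant derivatives are
    [f K] and [h K], so the claim amounts to [[w1,w2] + g K = f K].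

    Two facts give this.  First, a vertical connection is additive for both
    additive structures on [T^2 M] ([connection_add], [connection_addT]):
    [K] followed by [l] is, by the two linearity axioms, a composite of
    additive maps, and [l] is an additive monomorphism since [l K = 1], so
    additivity of [K l] descends to [K].  Secondly, [K] computes the bracket:
    if [d = <a l, b 0> T(+)], then [d K = a l K + b 0 K = a + 0 = a], which
    is [{d}] by definition ([connection_bracket]).  Hence
    applying [K] to [(f - g) + g = f] yields [[w1,w2] + g K = f K].

    Sums exist only for maps that agree over the base, and a sum written as a
    term carries a proof of that agreement.  The argument is therefore carried
    out with the ternary relation [adds B f g h], read [f + g = h], which
    carries no proofs and is transported along maps without any side
    condition. *)

Local Open Scope cat_scope.

(** * The addition relation of an additive bundle *)

Section Adds.

Variable C : Category.

Definition adds (E M : C) (q : E ~> M) (B : BundleData q) (Y : C)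
    (f g h : Y ~> E) : Prop :=
  exists s : Y ~> bn B 2, [/\ s ;; pr0 B = f, s ;; pr1 B = g & s ;; badd B = h].

Definition preserves_adds (E M E' M' : C) (q : E ~> M) (q' : E' ~> M')
    (B : BundleData q) (B' : BundleData q') (m : E ~> E') : Prop :=
  forall (Y : C) (f g h : Y ~> E),
    adds B f g h -> adds B' (f ;; m) (g ;; m) (h ;; m).

Section OneBundle.

Variables (E M : C) (q : E ~> M) (B : BundleData q).

Lemma bn2_unique (Y : C) (u v : Y ~> bn B 2) :
  u ;; pr0 B = v ;; pr0 B -> u ;; pr1 B = v ;; pr1 B -> u = v.
Proof.
move=> H0 H1; apply: (wp_unique (bn_wp B 2)); last first.
  rewrite -(wp_comm (bn_wp B 2) (@Ordinal 2 0 isT)) -!comp_assoc.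
  by congr (_ ;; _).
by case=> -[|[|//]] Hi; rewrite (bool_irrelevance Hi isT).
Qed.

Lemma adds_bsum (Y : C) (f g : Y ~> E) (H : f ;; q = g ;; q) :
  adds B f g (bsum B H).
Proof. by exists (bpair B H); rewrite bpair0 bpair1. Qed.

Lemma adds_uniq (Y : C) (f g h h' : Y ~> E) :
  adds B f g h -> adds B f g h' -> h = h'.
Proof.
move=> [s [s0 s1 <-]] [t [t0 t1 <-]]; congr (_ ;; _).
by apply: bn2_unique; rewrite ?s0 ?s1 ?t0 ?t1.
Qed.

Lemma adds_over (Y : C) (f g h : Y ~> E) : adds B f g h -> f ;; q = g ;; q.
Proof.
by move=> [s [<- <- _]]; rewrite !comp_assoc; congr (_ ;; _); exact: bn_pr_eq.
Qed.

Lemma adds_precomp (Z Y : C) (k : Z ~> Y) (f g h : Y ~> E) :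
  adds B f g h -> adds B (k ;; f) (k ;; g) (k ;; h).
Proof. by move=> [s [<- <- <-]]; exists (k ;; s); rewrite !comp_assoc. Qed.

Hypothesis ab : IsAdditiveBundle B.

Lemma adds_over_sum (Y : C) (f g h : Y ~> E) :
  adds B f g h -> h ;; q = f ;; q.
Proof. by move=> [s [<- _ <-]]; rewrite !comp_assoc (ab_add_over ab). Qed.

Lemma adds_comm (Y : C) (f g h : Y ~> E) : adds B f g h -> adds B g f h.
Proof.
move=> [s [<- <- <-]]; apply: adds_precomp.
by rewrite -(ab_comm ab); exact: adds_bsum.
Qed.

Lemma adds_assoc (Y : C) (f g h a b d : Y ~> E) :
  adds B f g a -> adds B a h b -> adds B g h d -> adds B f d b.
Proof.
move=> fg ah gh.
have fq := adds_over fg; have gq := adds_over gh.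
pose F (i : 'I_3) := match nat_of_ord i with 0 => f | 1 => g | _ => h end.
have Fq i : F i ;; q = f ;; q.
  by rewrite /F; case: (nat_of_ord i) => [|[|n]]; rewrite ?fq ?gq.
pose t := wp_lift (bn_wp B 3) Fq.
have t0 : t ;; pr0_3 B = f by rewrite /t [LHS]wp_lift_pr.
have t1 : t ;; pr1_3 B = g by rewrite /t [LHS]wp_lift_pr.
have t2 : t ;; pr2_3 B = h by rewrite /t [LHS]wp_lift_pr.
pose e01 : pr0_3 B ;; q = pr1_3 B ;; q := bn_pr_eq B _ _.
pose e12 : pr1_3 B ;; q = pr2_3 B ;; q := bn_pr_eq B _ _.
have H01 := adds_precomp t (adds_bsum e01).
have H12 := adds_precomp t (adds_bsum e12).
have HL := adds_precomp t (adds_bsum (bassoc_overl (ab_add_over ab))).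
have HR := adds_precomp t (adds_bsum (bassoc_overr (ab_add_over ab))).
rewrite t0 t1 in H01; rewrite t1 t2 in H12.
rewrite t2 (adds_uniq H01 fg) in HL.
rewrite t0 (adds_uniq H12 gh) -(ab_assoc ab) in HR.
by rewrite (adds_uniq ah HL).
Qed.

Lemma adds_zeror (Y : C) (f : Y ~> E) : adds B f (f ;; q ;; bzero B) f.
Proof.
have := adds_precomp f (adds_bsum (bzero_overr (ab_zero_over ab))).
by rewrite (ab_unitr ab) comp_idr -comp_assoc.
Qed.

End OneBundle.

Section TwoBundles.

Variables (E M E' M' : C) (q : E ~> M) (q' : E' ~> M').
Variables (B : BundleData q) (B' : BundleData q').

Lemma additive_preserves_adds (f1 : E ~> E') (f0 : M ~> M') :
  IsAdditiveMorphism B B' f1 f0 -> preserves_adds B B' f1.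
Proof.
move=> am Y f g h [s [<- <- <-]]; rewrite !comp_assoc.
by apply: adds_precomp; rewrite (am_add am); exact: adds_bsum.
Qed.

Lemma preserves_adds_comp (E'' M'' : C) (q'' : E'' ~> M'')
    (B'' : BundleData q'') (m : E ~> E') (m' : E' ~> E'') :
  preserves_adds B B' m -> preserves_adds B' B'' m' ->
  preserves_adds B B'' (m ;; m').
Proof.
by move=> Hm Hm' Y f g h H; rewrite -!comp_assoc; apply: Hm'; apply: Hm.
Qed.

(** Composing with the retraction turns the equation between the two candidate
    sums, which holds after [m], into one before [m]. *)
Lemma preserves_adds_cancel (E0 M0 : C) (q0 : E0 ~> M0) (B0 : BundleData q0)
    (k : E0 ~> E) (k0 : M0 ~> M) (m : E ~> E') (r : E' ~> E) :
  k ;; q = q0 ;; k0 -> m ;; r = idm E -> preserves_adds B B' m ->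
  preserves_adds B0 B' (k ;; m) -> preserves_adds B0 B k.
Proof.
move=> Hk mr Hm Hkm Y f g h H.
have e : f ;; k ;; q = g ;; k ;; q.
  by rewrite !comp_assoc Hk -!comp_assoc (adds_over H).
have S := adds_bsum B e.
have S' := Hkm _ _ _ _ H; rewrite -!comp_assoc in S'.
have e' := congr1 (fun u => u ;; r) (adds_uniq S' (Hm _ _ _ _ S)).
by rewrite !comp_assoc mr !comp_idr in e'; rewrite e'.
Qed.

End TwoBundles.

End Adds.

(** The relation [adds] is determined by its universal instance
    [pr0 + pr1 = badd], and a functor carries that instance to the universal
    instance of the image bundle. *)
Lemma fmap_preserves_adds (C D : Category) (F : Functor C D) (E M E' M' : C)
    (q : E ~> M) (q' : E' ~> M') (B : BundleData q) (B' : BundleData q')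
    pres pres' (m : E ~> E') :
  preserves_adds B B' m ->
  preserves_adds (image_bundle (F := F) (B := B) pres)
    (image_bundle (F := F) (B := B') pres') (fmap F m).
Proof.
move=> Hm Y f g h [s [<- <- <-]].
have [t [t0 t1 ta]] : adds B' (pr0 B ;; m) (pr1 B ;; m) (badd B ;; m).
  by apply: Hm; exists (idm _); rewrite !comp_idl.
exists (s ;; fmap F t); rewrite /pr0 /pr1 /=.
by split; rewrite !comp_assoc -!fmap_comp; congr (_ ;; fmap F _).
Qed.

(** * Sums and differences in a tangent category *)

Section Tangent.

Variables (C : Category) (X : TangentStructure C) (N : Negatives X).

Notation T := (tT X).
Notation p := (tp X).
Notation l := (tl X).
Notation c := (tc X).

Lemma tmap_preserves_adds (M M' : C) (k : M ~> M') :
  preserves_adds (tB X M) (tB X M') (fmap T k).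
Proof.
apply: (additive_preserves_adds (f0 := k)).
by exists (tp_nat X k); rewrite ?tadd_nat ?tzero_nat.
Qed.

(** Additivity of [l] as an axiom concerns [T(+)]; as [l c = l], the flip turns
    it into additivity for the tangent bundle of [T M]. *)
Lemma lift_preserves_adds (M : C) :
  preserves_adds (tB X M) (tB X (T M)) (l M).
Proof.
rewrite -[l M]tl_c.
exact: (preserves_adds_comp (additive_preserves_adds (tl_additive X M))
          (additive_preserves_adds (tc_additive X M))).
Qed.

Section Differences.

Variables (Y M : C).
Implicit Types f g h : Y ~> T M.

Lemma adds_neg f : adds (tB X M) f (f ;; tneg N M) (f ;; p M ;; tzero X M).
Proof.
have := adds_precomp f (adds_bsum (tB X M) (tneg_inv_over (tneg_over N) M)).
by rewrite tneg_inv comp_idr comp_assoc.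
Qed.

Lemma adds_tsub f g (H : f ;; p M = g ;; p M) :
  adds (tB X M) (tsub N f g H) g f.
Proof.
have ab := tB_additive X M.
have S : adds (tB X M) f (g ;; tneg N M) (tsub N f g H) by exact: adds_bsum.
have e : tsub N f g H ;; p M = g ;; p M by rewrite tsub_p H.
have Z := adds_comm ab (adds_neg g).
have R := adds_assoc ab S (adds_bsum _ e) Z.
have fz := adds_zeror ab f; rewrite H in fz.
by rewrite {2}(adds_uniq fz R); exact: adds_bsum.
Qed.

Lemma adds_cancelr f f' g h :
  adds (tB X M) f g h -> adds (tB X M) f' g h -> f = f'.
Proof.
have ab := tB_additive X M.
have recover k : adds (tB X M) k g h -> adds (tB X M) h (g ;; tneg N M) k.
  move=> S; have kg := adds_over S.
  have e : h ;; p M = (g ;; tneg N M) ;; p M.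
    by rewrite (adds_over_sum ab S) kg comp_assoc tneg_over.
  have R := adds_assoc ab S (adds_bsum _ e) (adds_neg g).
  have kz := adds_zeror ab k; rewrite kg in kz.
  by rewrite (adds_uniq kz R); exact: adds_bsum.
by move=> /recover S /recover S'; exact: adds_uniq S S'.
Qed.

End Differences.

(** * Additivity of a vertical connection *)

Section Connection.

Variables (M : C) (K : AffineVerticalConnection X M).

Lemma connection_add : preserves_adds (tB X (T M)) (tB X M) K.
Proof.
apply: (preserves_adds_cancel (avc_p K) (avc_l K)
          (lift_preserves_adds (M := M))).
rewrite avc_lin.
exact: (preserves_adds_comp (lift_preserves_adds (M := T M))
          (tmap_preserves_adds (avc K))).
Qed.

(** Sums formed with [T(+)] go to sums formed with [T(+)] one level up under
    [T(l)], and the flip then turns these into tangent sums. *)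
Lemma connection_addT : preserves_adds (tTB X M) (tB X M) K.
Proof.
have Kp : K ;; p M = fmap T (p M) ;; p M by rewrite avc_p tp_nat.
apply: (preserves_adds_cancel Kp (avc_l K) (lift_preserves_adds (M := M))).
rewrite avc_linT.
apply: (preserves_adds_comp (B' := tB X (T (T M)))); last first.
  exact: tmap_preserves_adds.
apply: (preserves_adds_comp (B' := tTB X (T M))).
  exact: fmap_preserves_adds (lift_preserves_adds (M := M)).
exact: additive_preserves_adds (tc_additive X (T M)).
Qed.

(** [0 K] is idempotent for addition, hence zero by cancellation. *)
Lemma connection_zero : tzero X (T M) ;; K = p M ;; tzero X M.
Proof.
have ab := tB_additive X (T M).
have z0 : tzero X (T M) ;; p (T M) = idm _ by exact: ab_zero_over.
have zz := adds_zeror ab (tzero X (T M)); rewrite z0 comp_idl in zz.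
have abM := tB_additive X M.
have S := adds_comm abM (adds_zeror abM (tzero X (T M) ;; K)).
rewrite (adds_cancelr (connection_add zz) S).
by rewrite !comp_assoc -(comp_assoc K) avc_p -!comp_assoc z0 comp_idl.
Qed.

(** In [f = <a l, b 0> T(+)], [K] undoes the lift on the vertical part [a] and
    kills the zero part. *)
Lemma connection_bracket (Y : C) (f : Y ~> T (T M))
    (H : f ;; fmap T (p M) = f ;; p (T M) ;; p M ;; tzero X M) :
  f ;; K = bracket H.
Proof.
set e := pb_lift (tmu_pb X M) H.
have S : adds (tTB X M) (e ;; (tpr0 X M ;; l M))
           (e ;; (tpr1 X M ;; tzero X (T M))) (e ;; mu X M).
  by apply: adds_precomp; exact: adds_bsum.
have SK := connection_addT S.
have pr01 : tpr1 X M ;; p M = tpr0 X M ;; p M by exact: bn_pr_eq.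
rewrite pb_lift_top !comp_assoc avc_l connection_zero comp_idr in SK.
rewrite -(comp_assoc (tpr1 X M)) pr01 -!comp_assoc in SK.
exact: adds_uniq SK (adds_zeror (tB_additive X M) _).
Qed.

Lemma lie_adds_connection (w1 w2 : VectorField X M) :
  adds (tB X M) (lie N w1 w2) (w2 ;; fmap T w1 ;; c M ;; K) (nabla K w1 w2).
Proof.
rewrite /lie -connection_bracket; apply: connection_add; exact: adds_tsub.
Qed.

End Connection.

End Tangent.

(** * The torsion formula *)

Theorem proposition3p31 (C : Category) (X : TangentStructure C)
    (N : Negatives X) (M : C) (K : AffineVerticalConnection X M)
    (w1 w2 : VectorField X M) :
  torsion_tensor N K w1 w2
  = tsub N
      (tsub N (nabla K w1 w2) (nabla K w2 w1) (nabla_over K w1 w2))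
      (lie N w1 w2)
      (nabla_lie_over N K w1 w2).
Proof.
have ab := tB_additive X M.
have tors := adds_precomp (w2 ;; fmap (tT X) w1) (adds_tsub N (torsion_over K)).
rewrite -comp_assoc -/(nabla K w2 w1) -/(torsion N K) in tors.
have diff := adds_tsub N (nabla_over K w1 w2).
have rhs := adds_tsub N (nabla_lie_over N K w1 w2).
have lieK := lie_adds_connection N K w1 w2.
have lt : lie N w1 w2 ;; tp X M = torsion_tensor N K w1 w2 ;; tp X M.
  by rewrite (adds_over lieK) (adds_over_sum ab tors).
have sum_lt := adds_bsum (tB X M) lt.
(* Regroup [lie + (torsion + nabla w2 w1)] as [(lie + torsion) + nabla w2 w1]. *)
have rt : bsum (tB X M) lt ;; tp X M = nabla K w2 w1 ;; tp X M.
  by rewrite (adds_over_sum ab sum_lt) lt (adds_over tors).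
have regroup := adds_assoc ab sum_lt (adds_bsum (tB X M) rt) tors.
have total := adds_bsum (tB X M) rt.
rewrite -(adds_uniq lieK regroup) in total.
rewrite (adds_cancelr N total diff) in sum_lt.
exact: (adds_cancelr N (adds_comm ab sum_lt) rhs).
Qed.
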